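(* Let $a,b\in\mathbb{R}$ with $|a|\geq 1$ and $a\neq -1$, and consider the difference equation $x_{n+1}=\dfrac{x_{n-1}}{a+bx_nx_{n-1}}$, $n\ge 0$, with real initial conditions $(x_{-1},x_0)\in\mathbb{R}^2$; put $\alpha=bx_{-1}x_0$. Then every admissible solution converges to zero if $\alpha\neq 1-a$, and is $2$-periodic if $\alpha=1-a$.
   Context: For real parameters $a,b$ and initial condition $(x_{-1},x_0)\in\mathbb{R}^2$, let $\alpha=bx_{-1}x_0$. For $a\neq -1$, the pair $(x_{-1},x_0)$ is an admissible initial condition if either $a=1$ and $\alpha\neq -1/n$ for all integers $n\ge 1$, or $a\ne 1$ and $\alpha\ne a^n(a-1)/(1-a^n)$ for all integers $n\geq 1$. Solutions $\{x_n\}_{n\ge -1}$ with admissible initial conditions are called admissible solutions. A solution is $2$-periodic if $x_{n+2}=x_n$ for all $n\ge -1$ (the minimal period may be $1$). *)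

(* Defs.v *)
From Stdlib Require Import Reals.
From Coquelicot Require Import Coquelicot.
Open Scope R_scope.

(** A sequence [x_{-1}, x_0, x_1, ...] is encoded as [x : nat -> R] with the
    index shifted by one: [x n] stands for [x_{n-1}], so that [x 0] and [x 1]
    are the initial values [x_{-1}] and [x_0]. *)

Definition alpha (b xm1 x0 : R) : R := b * xm1 * x0.

(** Meant for [a <> -1]. The exponent [n] is at least 1, so [INR n <> 0]; and
    [1 - a ^ n <> 0] in the second case. *)
Definition admissible (a b xm1 x0 : R) : Prop :=
  (a = 1 /\
     forall n : nat, (1 <= n)%nat -> alpha b xm1 x0 <> - 1 / INR n) \/
  (a <> 1 /\
     forall n : nat, (1 <= n)%nat ->
       alpha b xm1 x0 <> a ^ n * (a - 1) / (1 - a ^ n)).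

(** Division on [R] is total, so non-vanishing of the denominators is not part
    of this definition; for [a <> 0, -1] it follows from admissibility of the
    initial condition. *)
Definition is_solution (a b : R) (x : nat -> R) : Prop :=
  forall n : nat, x (S (S n)) = x n / (a + b * x (S n) * x n).

Definition admissible_solution (a b : R) (x : nat -> R) : Prop :=
  is_solution a b x /\ admissible a b (x 0%nat) (x 1%nat).

Definition two_periodic (x : nat -> R) : Prop :=
  forall n : nat, x (S (S n)) = x n.

(* Main.v *)
(** The product [y_n = b x_n x_(n+1)] satisfies [y_(n+1) = y_n / (a + y_n)], so
    [y_n = alpha / D_n] with [D_0 = 1] and [D_(n+1) = a D_n + alpha];
    admissibility says exactly that no [D_n] vanishes. Hence
    [x_(n+2) D_(n+1) = x_n D_n]. If [alpha = 1 - a], then [D_n = 1] for all [n]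
    and [x] is 2-periodic. Otherwise there are weights [g_n] tending to infinity
    for which [x_n^2 g_n] is eventually nonincreasing along each parity class:
    [g_n = ((1 + |a|) / 2)^n] if [|a| > 1], where [|D_(n+1) / D_n|] tends to
    [|a|], and [g_n = D_n / alpha = 1 / alpha + n] if [a = 1]. *)

Require Import Defs.
From Stdlib Require Import Reals Lra Lia.
From Coquelicot Require Import Coquelicot.
Open Scope R_scope.

Lemma bounded_of_two_step_nonincreasing (w : nat -> R) (N : nat) :
  (forall n, (N <= n)%nat -> w (S (S n)) <= w n) ->
  forall n, (N <= n)%nat -> w n <= Rmax (w N) (w (S N)).
Proof.
  intros Hw.
  (* Two consecutive indices, one per parity class, are carried along so that ordinary induction
     suits the two-step hypothesis. *)
  assert (H : forall k, w (N + k)%nat <= Rmax (w N) (w (S N)) /\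
                        w (S (N + k)) <= Rmax (w N) (w (S N))).
  { induction k as [|k [IH1 IH2]].
    - rewrite Nat.add_0_r. split; [apply Rmax_l | apply Rmax_r].
    - rewrite Nat.add_succ_r. split; [exact IH2|].
      apply Rle_trans with (2 := IH1). apply Hw. lia. }
  intros n Hn. replace n with (N + (n - N))%nat by lia. apply H.
Qed.

(** The weighted squares are eventually bounded by a constant [C], so [x n ^ 2 <= C / g n] once
    [g n] is positive, and the right side tends to zero. *)
Lemma lim_zero_of_weighted_squares (x g : nat -> R) :
  is_lim_seq g p_infty ->
  eventually (fun n => x (S (S n)) ^ 2 * g (S (S n)) <= x n ^ 2 * g n) ->
  is_lim_seq x 0.
Proof.
  intros Hg [N HN].
  pose proof (bounded_of_two_step_nonincreasing
                (fun n => x n ^ 2 * g n) N HN) as HC.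
  cbv beta in HC.
  set (C := Rmax _ _) in HC.
  apply is_lim_seq_spec. intros eps.
  apply is_lim_seq_spec in Hg.
  assert (He : 0 < eps ^ 2) by (apply pow_lt, cond_pos).
  destruct (Hg (Rmax 0 (C / eps ^ 2))) as [M HM].
  exists (Nat.max N M). intros n Hn.
  specialize (HC n ltac:(lia)). specialize (HM n ltac:(lia)).
  pose proof (Rmax_l 0 (C / eps ^ 2)). pose proof (Rmax_r 0 (C / eps ^ 2)).
  assert (HCg : C < g n * eps ^ 2).
  { apply Rmult_lt_reg_r with (/ eps ^ 2).
    - now apply Rinv_0_lt_compat.
    - rewrite Rmult_assoc, Rinv_r by lra.
      unfold Rdiv in *. lra. }
  rewrite Rminus_0_r.
  rewrite <- (Rabs_pos_eq eps) by (left; apply cond_pos).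
  apply Rsqr_lt_abs_0. unfold Rsqr. nra.
Qed.

Fixpoint denom (a al : R) (n : nat) : R :=
  match n with
  | O => 1
  | S m => a * denom a al m + al
  end.

(** For [a <> 1] the recursion has the fixed point [al / (1 - a)], and each step multiplies the
    deviation from it by [a]; the factor [a - 1] avoids the division. *)
Lemma denom_closed (a al : R) (n : nat) :
  (a - 1) * denom a al n = a ^ n * (a - 1 + al) - al.
Proof.
  induction n as [|n IH]; simpl; [ring|].
  replace ((a - 1) * (a * denom a al n + al))
    with (a * ((a - 1) * denom a al n) + (a - 1) * al) by ring.
  rewrite IH. ring.
Qed.

Lemma denom_one (al : R) (n : nat) : denom 1 al n = 1 + INR n * al.
Proof.
  induction n as [|n IH]; [simpl; ring|].
  rewrite S_INR. simpl denom. rewrite IH. ring.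
Qed.

Lemma eq_one_or_Rabs_gt_one (a : R) : 1 <= Rabs a -> a <> -1 -> a = 1 \/ 1 < Rabs a.
Proof. unfold Rabs. destruct (Rcase_abs a); lra. Qed.

(** Solving [denom a al n = 0] for [al] by the closed forms gives exactly the values that
    admissibility excludes. *)
Lemma admissible_denom_neq_0 (a b u v : R) :
  1 <= Rabs a -> a <> -1 -> admissible a b u v ->
  forall n, denom a (alpha b u v) n <> 0.
Proof.
  intros Ha Ha1 Hadm [|n]; [simpl; lra|].
  set (al := alpha b u v) in *. intros H0.
  destruct Hadm as [[-> H]|[Hne H]]; apply (H (S n)); try lia; fold al.
  - rewrite denom_one in H0.
    pose proof (lt_0_INR (S n) ltac:(lia)).
    apply Rmult_eq_reg_l with (INR (S n)); [|lra].
    field_simplify; lra.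
  - destruct (eq_one_or_Rabs_gt_one a Ha Ha1) as [|Hgt]; [contradiction|].
    assert (Hp : 1 - a ^ S n <> 0).
    { intros E. pose proof (Rlt_pow_R1 (Rabs a) (S n) Hgt ltac:(lia)) as L.
      rewrite RPow_abs in L. replace (a ^ S n) with 1 in L by lra.
      rewrite Rabs_R1 in L. lra. }
    pose proof (denom_closed a al (S n)) as E. rewrite H0 in E.
    apply Rmult_eq_reg_r with (1 - a ^ S n); [|exact Hp].
    unfold Rdiv. rewrite Rmult_assoc, Rinv_l by exact Hp. lra.
Qed.

Section Solution.

Context (a b : R) (x : nat -> R).
Let al := alpha b (x 0%nat) (x 1%nat).
Let D := denom a al.
Hypothesis Hsol : is_solution a b x.
Hypothesis HD : forall n, D n <> 0.

Lemma solution_product (n : nat) : b * x (S n) * x n = al / D n.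
Proof.
  induction n as [|n IH].
  - unfold al, alpha, D. simpl. field.
  - pose proof (HD n) as H1. pose proof (HD (S n)) as H2.
    change (D (S n)) with (a * D n + al) in *.
    rewrite (Hsol n), IH.
    (* Regrouping exposes the product at [n] again, for a second use of [IH]; [a + al / D n] is
       [D (S n) / D n], hence nonzero. *)
    transitivity (b * x (S n) * x n / (a + al / D n)).
    + field. split; [exact H1 | exact H2].
    + rewrite IH. field. split; [exact H2 | exact H1].
Qed.

Lemma solution_step (n : nat) : x (S (S n)) = x n * D n / D (S n).
Proof.
  pose proof (HD n) as H1. pose proof (HD (S n)) as H2.
  change (D (S n)) with (a * D n + al) in *.
  rewrite (Hsol n), solution_product. field. split; [exact H2 | exact H1].
Qed.

Lemma two_periodic_of_alpha_eq : al = 1 - a -> two_periodic x.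
Proof.
  intros Hal.
  assert (D1 : forall n, D n = 1).
  { induction n as [|n IH]; [reflexivity|].
    change (D (S n)) with (a * D n + al). rewrite IH, Hal. ring. }
  intros n. rewrite solution_step, !D1. field.
Qed.

Lemma lim_zero_of_eq_one : a = 1 -> al <> 0 -> is_lim_seq x 0.
Proof.
  intros Ha Hal.
  assert (HDn : forall n, D n = al * (/ al + INR n)).
  { intros n. unfold D. rewrite Ha, denom_one. now field. }
  apply (lim_zero_of_weighted_squares x (fun n => / al + INR n)).
  - eapply is_lim_seq_plus;
      [apply is_lim_seq_const | apply is_lim_seq_INR | reflexivity].
  - pose proof is_lim_seq_INR as Hp. apply is_lim_seq_spec in Hp.
    (* Past this threshold the weight is positive, even for negative [al]. *)
    destruct (Hp (- / al)) as [N HN].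
    exists N. intros n Hn. specialize (HN n Hn).
    rewrite solution_step, !HDn, !S_INR.
    set (z := / al + INR n).
    assert (Hz : 0 < z) by (unfold z; lra).
    replace (/ al + (INR n + 1)) with (z + 1) by (unfold z; ring).
    replace (/ al + (INR n + 1 + 1)) with (z + 2) by (unfold z; ring).
    (* The last factor is below 1 because [z * (z + 2) = (z + 1) ^ 2 - 1]. *)
    replace ((x n * (al * z) / (al * (z + 1))) ^ 2 * (z + 2))
      with (x n ^ 2 * z * (z * (z + 2) / (z + 1) ^ 2)) by (field; lra).
    rewrite <- (Rmult_1_r (x n ^ 2 * z)) at 2.
    apply Rmult_le_compat_l.
    + apply Rmult_le_pos; [apply pow2_ge_0 | lra].
    + apply Rle_div_l; nra.
Qed.

Lemma lim_zero_of_Rabs_gt_one : 1 < Rabs a -> al <> 1 - a -> is_lim_seq x 0.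
Proof.
  intros Ha Hal.
  (* [q > 1] makes the weights diverge, while [q < Rabs a] lets [Rabs (D n)] eventually grow by a
     factor of at least [q]. *)
  set (q := (1 + Rabs a) / 2).
  assert (Hq : 1 < q < Rabs a) by (unfold q; lra).
  (* The coefficient of [a ^ n] in the closed form, nonzero by [Hal]. *)
  set (c := a - 1 + al).
  assert (Hc : 0 < Rabs c) by (apply Rabs_pos_lt; unfold c; lra).
  apply (lim_zero_of_weighted_squares x (fun n => q ^ n)).
  - apply is_lim_seq_geom_p. apply Hq.
  - pose proof (is_lim_seq_geom_p (Rabs a) Ha) as Hp.
    apply is_lim_seq_spec in Hp.
    (* The threshold comes from solving [q * (|a|^n |c| + |al|) <= |a|^(n+1) |c| - |al|] for
       [|a|^n]. *)
    destruct (Hp ((1 + q) * Rabs al / ((Rabs a - q) * Rabs c))) as [N HN].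
    exists N. intros n Hn. specialize (HN n Hn).
    apply Rlt_div_l in HN; [|apply Rmult_lt_0_compat; lra].
    assert (Hgrow : q * Rabs (D n) <= Rabs (D (S n))).
    { assert (Ha1 : 0 < Rabs (a - 1)).
      { apply Rabs_pos_lt. intros E. replace a with 1 in Ha by lra.
        rewrite Rabs_R1 in Ha. lra. }
      apply Rmult_le_reg_l with (Rabs (a - 1)); [exact Ha1|].
      replace (Rabs (a - 1) * (q * Rabs (D n)))
        with (q * (Rabs (a - 1) * Rabs (D n))) by ring.
      rewrite <- !Rabs_mult. unfold D. rewrite !denom_closed. fold c.
      pose proof (Rabs_triang (a ^ n * c) (- al)) as T1.
      pose proof (Rabs_triang_inv (a ^ S n * c) al) as T2.
      rewrite Rabs_Ropp in T1.
      rewrite Rabs_mult, <- RPow_abs in T1, T2.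
      simpl (Rabs a ^ S n) in T2.
      apply Rle_trans with (2 := T2).
      apply Rle_trans with (q * (Rabs a ^ n * Rabs c + Rabs al)).
      - apply Rmult_le_compat_l; [lra | exact T1].
      - nra. }
    assert (Hsq : q ^ 2 * D n ^ 2 <= D (S n) ^ 2).
    { rewrite <- (pow2_abs (D n)), <- (pow2_abs (D (S n))), <- Rpow_mult_distr.
      apply pow_incr. split; [|exact Hgrow].
      apply Rmult_le_pos; [lra | apply Rabs_pos]. }
    pose proof (HD (S n)) as H1.
    rewrite solution_step.
    (* Two steps of the weight contribute [q ^ 2], which the squared ratio of consecutive
       denominators absorbs by [Hsq]. *)
    replace ((x n * D n / D (S n)) ^ 2 * q ^ S (S n))
      with (x n ^ 2 * q ^ n * (q ^ 2 * D n ^ 2 / D (S n) ^ 2))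
      by (simpl; field; exact H1).
    rewrite <- (Rmult_1_r (x n ^ 2 * q ^ n)) at 2.
    apply Rmult_le_compat_l.
    + apply Rmult_le_pos; [apply pow2_ge_0 | apply pow_le; lra].
    + apply Rle_div_l; [apply Rlt_gt, pow2_gt_0, H1 | lra].
Qed.

End Solution.

Theorem theorem3p2 (a b : R) (Ha : 1 <= Rabs a) (Ha1 : a <> -1)
    (x : nat -> R) (Hx : admissible_solution a b x) :
  (alpha b (x 0%nat) (x 1%nat) <> 1 - a -> is_lim_seq x 0) /\
  (alpha b (x 0%nat) (x 1%nat) = 1 - a -> two_periodic x).
Proof.
  destruct Hx as [Hsol Hadm].
  pose proof (admissible_denom_neq_0 _ _ _ _ Ha Ha1 Hadm) as HD.
  split; [|now apply two_periodic_of_alpha_eq].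
  intros Hal.
  destruct (eq_one_or_Rabs_gt_one a Ha Ha1) as [E|Hgt].
  - apply (lim_zero_of_eq_one a b x Hsol HD E). lra.
  - now apply (lim_zero_of_Rabs_gt_one a b x Hsol HD).
Qed.
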